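(* Let $\mathcal{H}_K$ be a contractive analytic Hilbert space over $\mathbb{B}^n$ with reproducing kernel $K$, and let $\mathcal{E}$, $\mathcal{E}_*$ be Hilbert spaces. Then each $K$-inner function $\Theta : \mathbb{B}^n \to \mathcal{B}(\mathcal{E},\mathcal{E}_* )$ is a contractive $K$-multiplier, that is, $\Theta f \in \mathcal{H}_K\otimes\mathcal{E}_*$ for every $f \in H^2_n\otimes\mathcal{E}$ and the multiplication operator $M_\Theta : H^2_n\otimes\mathcal{E}\to\mathcal{H}_K\otimes\mathcal{E}_*$, $f\mapsto\Theta f$, satisfies $\|M_\Theta\|\le 1$.
   Context: All Hilbert spaces are complex; $\mathbb{N}$ contains $0$; $\mathbb{B}^n$ is the open unit ball of $\mathbb{C}^n$. Let $K : \mathbb{B}^n\times\mathbb{B}^n\to\mathbb{C}$ be a positive definite function (i.e. a positive semidefinite kernel) and $\mathcal{H}_K$ the reproducing kernel Hilbert space with kernel $K$. $\mathcal{H}_K$ is a contractive analytic Hilbert space over $\mathbb{B}^n$ if it consists of analytic functions on $\mathbb{B}^n$ and the tuple $M_z=(M_{z_1},\ldots,M_{z_n})$ of multiplications by the coordinate functions is a (well-defined, bounded) pure row contraction on $\mathcal{H}_K$. Here a commuting tuple $T=(T_1,\dots,T_n)$ of bounded operators is a row contraction if $P_T(I)\le I$, where $P_T(X)=\sum_{i=1}^n T_iXT_i^*$, and it is pure if $P_T^m(I)\to 0$ strongly as $m\to\infty$. For a Hilbert space $\mathcal{E}_*$, $\mathcal{H}_K\otimes\mathcal{E}_*$ is identified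 with the $\mathcal{E}_*$-valued reproducing kernel Hilbert space with kernel $K(z,w)I_{\mathcal{E}_*}$, and $M_z$ also denotes the tuple $(M_{z_i}\otimes I_{\mathcal{E}_*})_{i}$ on it. $H^2_n$ is the Drury-Arveson space, the reproducing kernel Hilbert space on $\mathbb{B}^n$ with kernel $(1-\sum_{i=1}^n z_i\bar w_i)^{-1}$, and $H^2_n\otimes\mathcal{E}=H^2_n(\mathcal{E})$ is its $\mathcal{E}$-valued version. A function $\Theta:\mathbb{B}^n\to\mathcal{B}(\mathcal{E},\mathcal{E}_* )$ is a $K$-multiplier if the pointwise product $\Theta f : w\mapsto\Theta(w)f(w)$ belongs to $\mathcal{H}_K\otimes\mathcal{E}_*$ for every $f\in H^2_n\otimes\mathcal{E}$; then $M_\Theta:f\mapsto\Theta f$ is bounded. A function $\Theta:\mathbb{B}^n\to\mathcal{B}(\mathcal{E},\mathcal{E}_* )$ is $K$-inner if for all $x\in\mathcal{E}$ the function $\Theta x: z\mapsto\Theta(z)x$ belongs to $\mathcal{H}_K\otimes\mathcal{E}_*$ with $\|\Theta x\|_{\mathcal{H}_K\otimes\mathcal{E}_*}=\|x\|_{\mathcal{E}}$, and $\Theta\mathcal{E}\perp M_z^{k}(\Theta\mathcal{E})$ for all $k\in\mathbb{N}^n\setminus\{0\}$, where $\Theta\mathcal{E}=\{\Theta x:x\in\mathcal{E}\}$. *)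

(* Defs.v *)
From HB Require Import structures.
From mathcomp Require Import all_boot all_order all_algebra.
From mathcomp Require Import all_classical all_reals all_analysis.
From mathcomp Require Import complex.
Set Implicit Arguments.
Unset Strict Implicit.
Unset Printing Implicit Defensive.

Import Order.TTheory GRing.Theory Num.Theory.
Import numFieldNormedType.Exports.

Local Open Scope classical_set_scope.
Local Open Scope ring_scope.

(* The inner product is linear in its first argument. *)
Record hilbert (R : realType) := Hilbert {
  hilbert_sort :> completeNormedModType R[i] ;
  dot : {dot hilbert_sort for (@Num.conj R[i])} ;
  hilbert_normE : forall x : hilbert_sort, `|x| ^+ 2 = dot x x }.

Arguments dot {R h}.

Section ComplexLine.
Variable R : realType.

Local Notation C := R[i].

Lemma Re_le_norm (z : C) : `|complex.Re z| <= complex.Re `|z|.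
Proof.
by case: z => a b /=; rewrite -sqrtr_sqr ler_wsqrtr// lerDl sqr_ge0.
Qed.

Lemma Im_le_norm (z : C) : `|complex.Im z| <= complex.Re `|z|.
Proof.
by case: z => a b /=; rewrite -sqrtr_sqr ler_wsqrtr// lerDr sqr_ge0.
Qed.

Lemma norm_le_ReIm (z : C) :
  complex.Re `|z| <= `|complex.Re z| + `|complex.Im z|.
Proof.
case: z => a b /=.
rewrite -(ger0_norm (addr_ge0 (normr_ge0 a) (normr_ge0 b))) -sqrtr_sqr.
rewrite ler_wsqrtr// sqrrD !real_normK ?num_real// addrAC lerDl.
by rewrite mulrn_wge0// mulr_ge0.
Qed.

Lemma complex_complete (F : set_system C^o) :
  ProperFilter F -> cauchy F -> cvg F.
Proof.
move=> FF /cauchyP Fc.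
have part (p : C -> R) : {morph p : x y / x - y} ->
    (forall z, `|p z| <= complex.Re `|z|) -> cvg (p @ F).
  move=> pB pn; apply/cauchy_cvgP/cauchyP => e e0.
  have /Fc[z Fz] : 0 < (e%:C)%C :> C by rewrite ltcR.
  exists (p z); suff sub : ball z (e%:C)%C `<=` p @^-1` ball (p z) e.
    exact: filterS sub Fz.
  move=> y zy; suff : `|p (z - y)| < e by rewrite pB.
  apply: le_lt_trans (pn _) _.
  by move: zy; rewrite -ball_normE/= ltcE => /andP[].
have /cvg_ex[a Fa] : cvg (@complex.Re R @ F).
  by apply: part Re_le_norm => x y; rewrite raddfB.
have /cvg_ex[b Fb] : cvg (@complex.Im R @ F).
  by apply: part Im_le_norm => x y; rewrite raddfB.
apply/cvg_ex; exists (a +i* b)%C; apply/cvgrPdist_lt => e e0.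
have eE : e = (complex.Re e)%:C%C by rewrite RRe_real// gtr0_real.
have e20 : 0 < complex.Re e / 2 by rewrite divr_gt0// -ltcR -eE.
have /cvgrPdist_lt/(_ _ e20) {}Fa := Fa.
have /cvgrPdist_lt/(_ _ e20) {}Fb := Fb.
near=> z.
have za : `|a - complex.Re z| < complex.Re e / 2 by near: z; exact: Fa.
have zb : `|b - complex.Im z| < complex.Re e / 2 by near: z; exact: Fb.
set d := (_ - z); rewrite eE -[`|d|]RRe_real ?normr_real// ltcR.
apply: le_lt_trans (norm_le_ReIm _) _.
rewrite [complex.Re e]splitr /d.
by rewrite !raddfB/= ltrD.
Unshelve. all: by end_near. Qed.

(* Packed by hand: on [_^o] the library only infers completeness over a
   [realType]. *)
Definition complex_line : completeNormedModType C :=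
  HB.pack C^o (Uniform_isComplete.Build C^o complex_complete).

Definition cdot (u v : C^o) : C := u * Num.conj v.

Lemma cdot_bilinear :
  bilinear_for
    (GRing.Scale.Law.clone _ _ *%R _)
    (GRing.Scale.Law.clone _ _ (@Num.conj C \; *%R) _) cdot.
Proof.
split=> [w|w] a u v; rewrite /cdot/=.
  by rewrite mulrDl /GRing.scale/= mulrA.
by rewrite rmorphD rmorphM mulrDr mulrCA.
Qed.

HB.instance Definition _ := @bilinear_isBilinear.Build C C^o C^o C _ _ cdot cdot_bilinear.

Lemma cdot_hermitian u v : cdot u v = (-1) ^+ false * Num.conj (cdot v u).
Proof. by rewrite /cdot expr0 mul1r rmorphM mulrC; congr (_ * _); rewrite [RHS]conjCK. Qed.

HB.instance Definition _ :=
  isHermitianSesquilinear.Build C C^o false (@Num.conj C) cdot cdot_hermitian.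

Lemma cdot_gt0 (u : C^o) : u != 0 -> 0 < cdot u u.
Proof. by move=> u0; rewrite /cdot -normCK exprn_gt0// normr_gt0. Qed.

HB.instance Definition _ := isDotProduct.Build C C^o cdot cdot_gt0.

(* [C] itself, with [<u, v> = u v^*]; scalar kernels are [complex_hilbert]-valued
   ones. *)
Definition complex_hilbert : hilbert R :=
  @Hilbert R complex_line cdot (@normCK C).

End ComplexLine.

Section Operators.
Variable R : realType.
Local Notation C := R[i].
Implicit Types E F H : hilbert R.

(* Norms take their values in [R[i]], hence the real part.  The supremum is
   taken in the extended reals and is [+oo] when [T] is unbounded. *)
Definition op_norm E F (T : E -> F) : \bar R :=
  ereal_sup [set (complex.Re `|T x|)%:E | x in [set x : E | `|x| <= 1]].

Definition bounded_linear E F (T : E -> F) : Prop :=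
  linear T /\ (op_norm T < +oo)%E.

Record bounded_operator E F := BoundedOperator {
  bop_fun :> E -> F ;
  bop_bounded : bounded_linear bop_fun }.

(* The adjoint is unique when it exists, which it does for bounded [T] by the
   Riesz representation theorem. *)
Definition adjoint E F (T : E -> F) (y : F) : E :=
  xget 0 [set x | forall h, dot (T h) y = dot h x].

Section Tuples.
Variables (n : nat) (H : hilbert R) (T : 'I_n -> H -> H).

(* [P_T (X) = \sum_i T_i X T_i^*] *)
Definition P_map (X : H -> H) : H -> H :=
  fun h => \sum_i T i (X (adjoint (T i) h)).

Record row_contraction : Prop := RowContraction {
  rc_bounded : forall i, bounded_linear (T i) ;
  rc_commute : forall i j h, T i (T j h) = T j (T i h) ;
  rc_le1 : forall h, dot (P_map id h) h <= dot h h }.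

Definition pure : Prop :=
  forall h, (fun m => iter m P_map id h) @ \oo --> (0 : H).

Definition multi_power (k : 'I_n -> nat) : H -> H :=
  \big[comp/id]_(i < n) iter (k i) (T i).

End Tuples.
End Operators.

Section Kernels.
Variables (R : realType) (n : nat).
Local Notation C := R[i].

Definition unit_ball (z : 'rV[C]_n) : Prop := \sum_i `|z 0 i| ^+ 2 < 1.

(* Functions on the ball are represented by functions on all of [C^n]; their
   values outside of the ball are irrelevant everywhere below. *)
Definition kernel_fun : Type := 'rV[C]_n -> 'rV[C]_n -> C.

Definition positive_definite (K : kernel_fun) : Prop :=
  forall (m : nat) (z : 'I_m -> 'rV[C]_n) (c : 'I_m -> C),
    (forall i, unit_ball (z i)) ->
    0 <= \sum_i \sum_j c i * Num.conj (c j) * K (z i) (z j).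

(* [rkhs E K] is the type of models of the [E]-valued reproducing kernel
   Hilbert space with kernel [K (z, w) I_E], that is, of [H_K \otimes E]:
   Hilbert spaces of [E]-valued functions on the ball ([ev f] is the function
   that [f] stands for) containing all the [K (., w) x] and in which
   [<f, K (., w) x> = <f w, x>].  Any two models are isomorphic through their
   [ev]. *)
Record rkhs (E : hilbert R) (K : kernel_fun) := Rkhs {
  rkhs_space :> hilbert R ;
  ev : rkhs_space -> 'rV[C]_n -> E ;
  ev_linear : forall z, unit_ball z -> linear (ev^~ z) ;
  ev_inj : forall f, (forall z, unit_ball z -> ev f z = 0) -> f = 0 ;
  ev_reproducing : forall w (x : E), unit_ball w ->
    exists k : rkhs_space,
      (forall z, unit_ball z -> ev k z = K z w *: x) /\
      (forall f, dot f k = dot (ev f w) x) }.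

Definition drury_arveson : kernel_fun :=
  fun z w => (1 - \sum_i z 0 i * Num.conj (w 0 i))^-1.

Section Membership.
Variables (E : hilbert R) (K : kernel_fun) (F : rkhs E K).

Definition in_rkhs (f : 'rV[C]_n -> E) : Prop :=
  exists g : F, forall z, unit_ball z -> ev g z = f z.

Definition to_rkhs (f : 'rV[C]_n -> E) : F :=
  xget 0 [set g : F | forall z, unit_ball z -> ev g z = f z].

Definition coord_mul (i : 'I_n) (f : F) : 'rV[C]_n -> E :=
  fun z => z 0 i *: ev f z.

Definition Mz (i : 'I_n) (f : F) : F := to_rkhs (coord_mul i f).

End Membership.

(* Analytic functions of several complex variables are the complex
   (Frechet-)differentiable ones; the scalars of [differentiable] are [R[i]]
   here. *)
Definition analytic (f : 'rV[C]_n -> complex_line R) : Prop :=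
  forall z : ('rV[C]_n : normedModType C), unit_ball z -> differentiable f z.

Record contractive_analytic (K : kernel_fun) (HK : rkhs (complex_hilbert R) K)
    : Prop := ContractiveAnalytic {
  ca_analytic : forall f : HK, analytic (ev f) ;
  ca_invariant : forall i (f : HK), in_rkhs HK (coord_mul i f) ;
  ca_row_contraction : row_contraction (@Mz _ _ HK) ;
  ca_pure : pure (@Mz _ _ HK) }.

Section Multipliers.
Variables (E Estar : hilbert R) (K : kernel_fun).
Variables (H2E : rkhs E drury_arveson) (HKE : rkhs Estar K).
Variable Theta : 'rV[C]_n -> bounded_operator E Estar.

Definition K_multiplier : Prop :=
  forall f : H2E, in_rkhs HKE (fun z => Theta z (ev f z)).

Definition M_Theta (f : H2E) : HKE := to_rkhs HKE (fun z => Theta z (ev f z)).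

Definition Theta_vec (x : E) : HKE := to_rkhs HKE (fun z => Theta z x).

Record K_inner : Prop := KInner {
  ki_mem : forall x, in_rkhs HKE (fun z => Theta z x) ;
  ki_norm : forall x, `|Theta_vec x| = `|x| ;
  ki_wandering : forall k : 'I_n -> nat, (exists i, k i != 0%N) ->
    forall x y, dot (Theta_vec x) (multi_power (@Mz _ _ HKE) k (Theta_vec y)) = 0 }.

End Multipliers.
End Kernels.

Arguments drury_arveson {R n}.
Arguments M_Theta {R n E Estar K} H2E HKE Theta f.

(* Main.v *)
(* Let V x = Theta x.  Since V E is wandering for M_z and M_z is a row
   contraction, splitting off the constant term and inducting on the degree
   shows that a noncommutative polynomial sum_a M_z^a V x_a, the sum being over
   words a, has norm at most (sum_a |x_a|^2)^(1/2).  For w_i in the ball and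
   y_i = Theta(w_i)^* eta_i take x_a = sum_i conj(w_i^a) y_i over the words a of
   length at most m: the polynomial then pairs with
   h = sum_i K(., w_i) eta_i to sum_a |x_a|^2, so this sum is at most |h|^2, and
   letting m tend to infinity gives
     |sum_i k(., w_i) y_i| <= |sum_i K(., w_i) eta_i|
   with k the Drury-Arveson kernel.  Thus K(., w) eta |-> k(., w) Theta(w)^* eta
   extends to a contraction, whose adjoint is M_Theta.  That M_z is a row
   contraction on the Estar-valued space as well follows from a Schur product
   argument on kernels. *)
Require Import Defs.
From mathcomp Require Import all_boot all_order all_algebra.
From mathcomp Require Import all_classical all_reals all_analysis.
From mathcomp Require Import complex.
From mathcomp Require Import ring lra.
Set Implicit Arguments.
Unset Strict Implicit.
Unset Printing Implicit Defensive.
Import Order.TTheory GRing.Theory Num.Theory.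
Import numFieldNormedType.Exports.
Local Open Scope classical_set_scope.
Local Open Scope ring_scope.

(** * Inner products and real-valued norms in a complex Hilbert space *)

Section Hilbert.
Variable R : realType.
Local Notation C := R[i].
Implicit Type H : hilbert R.

Lemma dotC H (u v : H) : dot u v = Num.conj (dot v u).
Proof. by have := hermC (@dot _ H) u v; rewrite expr0 mul1r. Qed.

Lemma dotDl H (u v w : H) : dot (u + v) w = dot u w + dot v w.
Proof. by rewrite linearDl. Qed.

Lemma dotDr H (u v w : H) : dot u (v + w) = dot u v + dot u w.
Proof. by rewrite linearDr. Qed.

Lemma dotZl H a (u w : H) : dot (a *: u) w = a * dot u w.
Proof. by rewrite linearZl_LR. Qed.

Lemma dotZr H a (u w : H) : dot u (a *: w) = Num.conj a * dot u w.
Proof. by rewrite linearZr_LR. Qed.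

Lemma dot0l H (w : H) : dot 0 w = 0.
Proof. by rewrite linear0l. Qed.

Lemma dot0r H (w : H) : dot w 0 = 0.
Proof. by rewrite linear0r. Qed.

Lemma dotBl H (u v w : H) : dot (u - v) w = dot u w - dot v w.
Proof. by rewrite linearBl. Qed.

Lemma dotBr H (u v w : H) : dot u (v - w) = dot u v - dot u w.
Proof. by rewrite linearBr. Qed.

Lemma dot_suml H I (r : seq I) (P : pred I) (F : I -> H) w :
  dot (\sum_(i <- r | P i) F i) w = \sum_(i <- r | P i) dot (F i) w.
Proof. by rewrite linear_sumlz. Qed.

Lemma dot_sumr H I (r : seq I) (P : pred I) (F : I -> H) w :
  dot w (\sum_(i <- r | P i) F i) = \sum_(i <- r | P i) dot w (F i).
Proof. by rewrite linear_sumr. Qed.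

Lemma dot_ge0 H (u : H) : 0 <= dot u u.
Proof. exact: dnorm_ge0. Qed.

Lemma dot_eq0 H (u : H) : (dot u u == 0) = (u == 0).
Proof. exact: dnorm_eq0. Qed.

Lemma dot_injr H (u v : H) : (forall h, dot h u = dot h v) -> u = v.
Proof.
by move=> uv; apply/eqP; rewrite -subr_eq0 -dot_eq0 dotBr uv subrr.
Qed.

Lemma dot_le H (u v : H) : `|dot u v| <= `|u| * `|v|.
Proof.
rewrite -(@ler_pXn2r _ 2)// ?nnegrE ?mulr_ge0// exprMn !hilbert_normE.
have [->|v0] := eqVneq v 0; first by rewrite !dot0r normr0 expr0n mulr0.
have vv : 0 < dot v v by rewrite lt0r dot_ge0 dot_eq0 v0.
set a := dot u v / dot v v.
have ov : dot (u - a *: v) v = 0 by rewrite dotBl dotZl divfK ?subrr ?gt_eqF.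
have := dot_ge0 (u - a *: v); rewrite dotBr dotZr ov mulr0 subr0.
rewrite dotBl dotZl (dotC v u) mulrAC subr_ge0 ler_pdivrMr//.
by rewrite -normCK.
Qed.

(** Real-valued, so that infima, square roots and real arithmetic apply; by [hnormE] nothing is
    lost. *)
Definition hnorm H (u : H) : R := complex.Re `|u|.

Lemma hnormE H (u : H) : `|u| = ((hnorm u)%:C)%C.
Proof. by rewrite RRe_real// normr_real. Qed.

Lemma hnorm_ge0 H (u : H) : 0 <= hnorm u.
Proof. by rewrite -lecR -hnormE normr_ge0. Qed.

Lemma dot_hnorm H (u : H) : dot u u = ((hnorm u ^+ 2)%:C)%C.
Proof. by rewrite -hilbert_normE hnormE rmorphXn. Qed.

Lemma hnormZ H a (u : H) : hnorm (a *: u) = complex.Re `|a| * hnorm u.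
Proof.
by apply: complexI; rewrite -hnormE normrZ rmorphM/= -(hnormE u).
Qed.

Lemma hnormD_le H (u v : H) : hnorm (u + v) <= hnorm u + hnorm v.
Proof. by rewrite -lecR rmorphD/= -!hnormE ler_normD. Qed.

Lemma hnorm_eq0 H (u : H) : (hnorm u == 0) = (u == 0).
Proof. by rewrite -(normr_eq0 u) hnormE (inj_eq (@complexI _)). Qed.

Lemma hnorm0 H : hnorm (0 : H) = 0.
Proof. by apply/eqP; rewrite hnorm_eq0. Qed.

Lemma Re_dot_le H (u v : H) : complex.Re `|dot u v| <= hnorm u * hnorm v.
Proof.
by rewrite -lecR rmorphM/= -!hnormE dot_le.
Qed.

Lemma addr_conjc (d : C) : d + Num.conj d = ((2 * complex.Re d)%:C)%C.
Proof.
case: d => a b; apply/eqP; rewrite eq_complex/=.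
by rewrite subrr eqxx andbT mulrDl !mul1r.
Qed.

Lemma sqr_hnormD H (u v : H) :
  hnorm (u + v) ^+ 2 = hnorm u ^+ 2 + hnorm v ^+ 2 + 2 * complex.Re (dot u v).
Proof.
apply: complexI; rewrite -dot_hnorm dotDl !dotDr (dotC v u).
rewrite rmorphD/= -addr_conjc rmorphD/= -[RHS]/(_ + _ + _) -!dot_hnorm; ring.
Qed.

Lemma parallelogram H (u v : H) :
  hnorm (u - v) ^+ 2 + hnorm (u + v) ^+ 2 =
  2 * (hnorm u ^+ 2) + 2 * (hnorm v ^+ 2).
Proof.
rewrite !sqr_hnormD -scaleN1r hnormZ normrN1 mul1r.
rewrite dotZr rmorphN1 mulN1r raddfN /=; ring.
Qed.

End Hilbert.

(* The Riesz representation theorem for a partially defined bounded functional,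
   given by its graph [S]: [g] is the limit of a minimizing sequence of
   [|u|^2 - 2 Re c] over the graph. *)
Section Riesz.
Variable R : realType.
Local Notation C := R[i].
Variables (H : hilbert R) (S : H -> C -> Prop) (M : R).
Hypothesis S0 : S 0 0.
Hypothesis SP : forall a u c v d, S u c -> S v d -> S (a *: u + v) (a * c + d).
Hypothesis Sle : forall u c, S u c -> complex.Re `|c| <= M * hnorm u.

Let J (u : H) (c : C) : R := hnorm u ^+ 2 - 2 * complex.Re c.

Let infJ : R := inf [set J p.1 p.2 | p in [set p | S p.1 p.2]].

(** Since Re c <= M |u|, the functional is at least (|u| - M)^2 - M^2. *)
Let J_lb : lbound [set J p.1 p.2 | p in [set p | S p.1 p.2]] (- M ^+ 2).
Proof.
move=> _ [[u c]/= Suc <-]; rewrite /J.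
have := le_trans (ler_norm _) (le_trans (Re_le_norm c) (Sle Suc)).
have := sqr_ge0 (hnorm u - M); nra.
Qed.

Let infJ_le u c : S u c -> infJ <= J u c.
Proof.
by move=> Suc; apply: ge_inf; [exists (- M ^+ 2); exact: J_lb | exists (u, c)].
Qed.

Let infJ_adherent (e : R) : 0 < e -> exists u c, S u c /\ J u c < infJ + e.
Proof.
move=> e0.
have : has_inf [set J p.1 p.2 | p in [set p | S p.1 p.2]].
  by split; [exists (J 0 0); exists (0, 0) | exists (- M ^+ 2); exact: J_lb].
by case/(inf_adherent e0) => _ [[u c]/= Suc <-] Je; exists u, c.
Qed.

Let SZ a u c : S u c -> S (a *: u) (a * c).
Proof. by move=> /(SP a)/(_ S0); rewrite !addr0. Qed.

(** Parallelogram identity, combined with [infJ_le] at the midpoint of the two graph points. *)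
Let J_dist u c v d : S u c -> S v d ->
  hnorm (u - v) ^+ 2 <= 2 * (J u c - infJ) + 2 * (J v d - infJ).
Proof.
move=> Su Sv.
have S2 : S (2^-1 *: (u + v)) (2^-1 * (c + d)).
  by apply: SZ; rewrite -(scale1r u) -(mul1r c); exact: SP.
have := infJ_le S2; rewrite /J hnormZ.
have := parallelogram u v.
have half : 2^-1 = ((2^-1)%:C)%C :> C by rewrite fmorphV rmorph_nat.
have -> : complex.Re `|2^-1 : C| = 2^-1 by rewrite ger0_norm ?invr_ge0// half.
have -> : complex.Re (2^-1 * (c + d)) = 2^-1 * (complex.Re c + complex.Re d).
  by rewrite half; case: (c) => ? ?; case: (d) => ? ?; rewrite /= mul0r subr0.
lra.
Qed.


(** By [J_dist] a minimizing sequence is Cauchy. Its limit g need not lie in the domain of the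
    graph, so only approximants u near g are recorded. *)
Let minimizer : exists g, forall e : R, 0 < e ->
  exists u c, [/\ S u c, J u c < infJ + e & hnorm (g - u) < e].
Proof.
have /choice[p pP] : forall k : nat, exists p : H * C,
    S p.1 p.2 /\ J p.1 p.2 < infJ + k.+1%:R^-1.
  by move=> k; have [|u [c ?]] := @infJ_adherent k.+1%:R^-1; [|exists (u, c)].
have pd (e : R) : 0 < e -> exists N, forall k l, (N <= k)%N -> (N <= l)%N ->
    hnorm ((p k).1 - (p l).1) < e.
  (* When both values of [J] exceed [infJ] by less than e^2 / 4, the bound of [J_dist] stays below
     e^2. *)
  move=> e0; have e20 : 0 < e ^+ 2 / 4 by rewrite divr_gt0// exprn_gt0.
  have [N _ NP] := near_infty_natSinv_lt (PosNum e20).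
  exists N => k l Nk Nl; rewrite -(ltr_pXn2r (n:=2)) ?nnegrE ?hnorm_ge0 ?ltW//.
  apply: le_lt_trans (J_dist (pP k).1 (pP l).1) _.
  have /= := NP k Nk; have /= := NP l Nl; have := (pP k).2; have := (pP l).2.
  move: (J _ _) (J _ _) (_^-1 : R) (_^-1 : R) => ? ? ? ?; lra.
pose q : nat -> H := fun k => (p k).1.
have : cauchy (q @ \oo).
  apply/cauchyP => e e0.
  have eE : e = ((complex.Re e)%:C)%C by rewrite RRe_real// gtr0_real.
  have [|N NP] := pd (complex.Re e); first by rewrite -ltcR -eE.
  exists (q N), N => // k /= Nk.
  rewrite -ball_normE /= hnormE eE ltcR; exact: NP.
move/cauchy_cvgP/cvg_ex => [g qg].
exists g => e e0.
have [N _ NP] := near_infty_natSinv_lt (PosNum e0).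
have /cvgrPdist_lt/(_ (e%:C)%C) := qg; rewrite ltcR => /(_ e0) [N' _ NP'].
exists (p (maxn N N')).1, (p (maxn N N')).2; split.
- exact: (pP _).1.
- by apply: lt_trans (pP _).2 _; rewrite ltrD2l; apply: NP => /=; rewrite leq_maxl.
- by rewrite -ltcR -hnormE; apply: NP' => /=; rewrite leq_maxr.
Qed.

(* Minimality tested at [u + t h] with [t = - s conj (<h, u> - c)]. *)
Let J_slope u b h c (e : R) : S u b -> S h c -> J u b < infJ + e ->
  complex.Re `|dot h u - c| ^+ 2 <= e * (1 + hnorm h ^+ 2).
Proof.
move=> Su Sh Je; set d := dot h u - c; set D := complex.Re `|d|.
have N0 := sqr_ge0 (hnorm h).
(* The best s would be 1 / |h|^2; adding 1 keeps the denominator positive and still lowers [J] by at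
   least s D^2, whence s D^2 <= e. *)
pose s := (1 + hnorm h ^+ 2)^-1.
have s1 : s * (1 + hnorm h ^+ 2) = 1 by rewrite mulVf// gt_eqF// ltr_wpDr.
have s0 : 0 < s by rewrite invr_gt0 ltr_wpDr.
pose t : C := - (s%:C)%C * Num.conj d.
have := infJ_le (SP t Sh Su); rewrite /J (addrC (t *: h)) sqr_hnormD hnormZ.
have td : t * d = (- (s * D ^+ 2))%:C%C.
  rewrite /t mulNr rmorphN rmorphM rmorphXn /= mulNr -mulrA (mulrC _ d) -normCK.
  by rewrite RRe_real ?normr_real.
have tn : complex.Re `|t| = s * D.
  rewrite /t normrM normrN norm_conjC ger0_norm ?lecR ?ltW// /D.
  by rewrite /= mul0r subr0.
have -> : complex.Re (dot u (t *: h)) = complex.Re (t * dot h u).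
  by rewrite dotC dotZl; case: (t * _).
have -> : complex.Re (t * c + b) = complex.Re (t * dot h u) + s * D ^+ 2 + complex.Re b.
  have -> : t * c = t * dot h u - t * d by rewrite /d; ring.
  by rewrite td; case: (t * _) => ? ?; case: (b) => ? ?; rewrite /= opprK.
rewrite tn; move: Je; rewrite /J => Je.
have s1' : s * hnorm h ^+ 2 = 1 - s by rewrite -s1; ring.
have -> : (s * D * hnorm h) ^+ 2 = s * D ^+ 2 * (s * hnorm h ^+ 2) by ring.
rewrite s1' => L.
have sD : s * D ^+ 2 <= e by have := mulr_ge0 (ltW s0) (sqr_ge0 D); nra.
have -> : D ^+ 2 = (s * D ^+ 2) * (1 + hnorm h ^+ 2) by rewrite mulrAC s1 mul1r.
by rewrite ler_wpM2r// addr_ge0.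
Qed.

Lemma riesz_relation : 0 <= M ->
  exists2 g, hnorm g <= M & forall u c, S u c -> dot u g = c.
Proof.
move=> M0; have [g gP] := minimizer.
have gS h c : S h c -> dot h g = c.
  move=> Sh; apply/eqP; rewrite -subr_eq0 -normr_eq0.
  set D := complex.Re `|dot h g - c|.
  have ReN (z : C) : 0 <= complex.Re `|z| by apply: le_trans (Re_le_norm z).
  have -> : `|dot h g - c| = (D%:C)%C by [].
  rewrite (inj_eq (@complexI _)); apply/negPn/negP => Dn0.
  have D0 : 0 < D by rewrite lt0r Dn0 ReN.
  have N0 := hnorm_ge0 h; set n := hnorm h in N0.
  (* The [e] built from this is at most 1, so D <= n e + X with X^2 <= e (1 + n^2) gives D^2 <= 4 e
     (1 + n^2) <= D^2 / 2, contradicting D > 0. *)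
  have d0 : 0 < 8 * (1 + n ^+ 2) + D ^+ 2 by have := sqr_ge0 n; nra.
  pose e := D ^+ 2 / (8 * (1 + n ^+ 2) + D ^+ 2).
  have e0 : 0 < e by rewrite divr_gt0// exprn_gt0.
  have ed : e * (8 * (1 + n ^+ 2) + D ^+ 2) = D ^+ 2 by rewrite mulfVK// gt_eqF.
  have [u [b [Su Ju gu]]] := gP e e0.
  have := J_slope Su Sh Ju; set X := complex.Re _ => X2.
  have DX : D <= n * e + X.
    apply: (@le_trans _ _ (n * hnorm (g - u) + X)).
      apply: (le_trans _ (lerD (Re_dot_le h (g - u)) (lexx X))).
      rewrite -lecR rmorphD; have := ler_normD (dot h (g - u)) (dot h u - c).
      by rewrite {1}dotBr addrA subrK.
    by rewrite lerD2r ler_wpM2l// ltW.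
  have X0 : 0 <= X by exact: ReN.
  have n20 := sqr_ge0 n.
  have e1 : e <= 1 by nra.
  have : D ^+ 2 <= 2 * (n * e) ^+ 2 + 2 * X ^+ 2.
    have := sqr_ge0 (n * e - X); have : D ^+ 2 <= (n * e + X) ^+ 2.
      by have := mulr_ge0 N0 (ltW e0); nra.
    lra.
  have : (n * e) ^+ 2 <= e * n ^+ 2.
    by rewrite exprMn mulrC ler_wpM2r// expr2 ger_pMl.
  have := exprn_gt0 2 D0.
  nra.
exists g => //; rewrite leNgt; apply/negP => Mg.
set G := hnorm g in Mg.
have G0 : 0 < G := le_lt_trans M0 Mg.
(* As <u, g> = c has real part at most M |u| <= M (G + e), one gets G^2 <= e G + M (G + e); the [e]
   below makes e (G + M) smaller than G (G - M), a contradiction. *)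
have d0 : 0 < G + M + 1 by lra.
pose e := (G - M) * G / (G + M + 1).
have e0 : 0 < e by rewrite divr_gt0 ?mulr_gt0 ?subr_gt0.
have ed : e * (G + M + 1) = (G - M) * G by rewrite mulfVK// gt_eqF.
have [u [c [Su _ gu]]] := gP e e0.
have uG : hnorm u <= G + e.
  rewrite -(subrK g u) (le_trans (hnormD_le _ _))// addrC lerD2l.
  by rewrite -opprB -scaleN1r hnormZ normrN1 mul1r ltW.
have : G ^+ 2 <= e * G + M * (G + e).
  have -> : G ^+ 2 = complex.Re (dot (g - u) g) + complex.Re (dot u g).
    by rewrite dotBl dot_hnorm; case: (dot u g) => ? ?; rewrite /= subrK.
  apply: lerD.
    apply: le_trans (ler_norm _) _; apply: le_trans (Re_le_norm _) _.
    by apply: le_trans (Re_dot_le _ _) _; rewrite ler_wpM2r ?ltW.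
  apply: le_trans (ler_norm _) _; apply: le_trans (Re_le_norm _) _.
  by rewrite (gS _ _ Su) (le_trans (Sle Su))// ler_wpM2l.
nra.
Qed.

End Riesz.

(** * Cauchy-Schwarz for finite real sums and a Schur product inequality *)

Lemma sum_mulr_sqr (R : realDomainType) n (a b : 'I_n -> R) :
  (\sum_i a i * b i) ^+ 2 <= (\sum_i a i ^+ 2) * (\sum_i b i ^+ 2).
Proof.
set A := \sum_i a i ^+ 2; set B := \sum_i b i ^+ 2; set c := \sum_i a i * b i.
have : 0 <= B by apply: sumr_ge0 => i _; exact: sqr_ge0.
rewrite le_eqVlt eq_sym => /orP[/eqP B0|B0].
  have b0 i : b i = 0.
    apply/eqP; rewrite -(sqrf_eq0 (b i)); move: B0 => /psumr_eq0P -> //.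
    by move=> j _; exact: sqr_ge0.
  by rewrite B0 mulr0 /c big1 ?expr0n// => i _; rewrite b0 mulr0.
rewrite -subr_ge0 -(pmulr_rge0 _ B0).
have sqE x y : \sum_i (x * a i - y * b i) ^+ 2 =
    x ^+ 2 * A - 2 * x * y * c + y ^+ 2 * B.
  rewrite !mulr_sumr -sumrB -big_split; apply: eq_bigr => i _ /=; ring.
have -> : B * (A * B - c ^+ 2) = \sum_i (B * a i - c * b i) ^+ 2.
  by rewrite sqE; ring.
by apply: sumr_ge0 => i _; exact: sqr_ge0.
Qed.

(* Schur product with a Gram matrix, by Gram-Schmidt: removing from all the
   vectors their component along one of them makes that one vanish. *)
Lemma psd_gram (R : realType) (E : hilbert R) (I : finType)
    (A : I -> I -> R[i]) (eta : I -> E) :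
  (forall c : I -> R[i], 0 <= \sum_i \sum_j c i * Num.conj (c j) * A i j) ->
  0 <= \sum_i \sum_j A i j * dot (eta i) (eta j).
Proof.
move=> A0; have [m] := ubnP #|[pred i | eta i != 0]|.
elim: m eta => // m IH eta em.
have [/existsP[i0 ei0]|/existsPn e0] := boolP [exists i, eta i != 0]; last first.
  rewrite big1// => i _; rewrite big1// => j _.
  by have /negPn/eqP -> := e0 i; rewrite dot0l mulr0.
set v := eta i0 in ei0; set N := dot v v.
have N0 : N != 0 by rewrite dot_eq0.
pose a i := dot (eta i) v / N.
have [eta' eta'E] : exists f, forall i, f i = eta i - a i *: v.
  by exists (fun i => eta i - a i *: v).
have ov i : dot (eta' i) v = 0 by rewrite eta'E dotBl dotZl divfK// subrr.
(* The residuals are orthogonal to [v], so the Gram matrix is theirs plus a rank-one term, to which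
   the hypothesis on [A] applies with [c := a]. *)
have dE i j : dot (eta i) (eta j) =
    dot (eta' i) (eta' j) + a i * Num.conj (a j) * N.
  rewrite -[eta i](subrK (a i *: v)) -[eta j](subrK (a j *: v)) -!eta'E.
  rewrite dotDl !dotDr !dotZl !dotZr ov (dotC v) ov rmorph0 !mulr0 addr0 add0r.
  by rewrite mulrA.
under eq_bigr => i _ do under eq_bigr => j _ do rewrite dE mulrDr.
under eq_bigr => i _ do rewrite big_split.
rewrite big_split addr_ge0//=.
  apply: IH; rewrite ltnS in em; apply: leq_trans em; apply: proper_card.
  apply/properP; split.
    apply/fintype.subsetP => i; rewrite !inE; apply: contraNN => /eqP e0.
    by rewrite eta'E /a e0 dot0l mul0r scale0r subr0.
  exists i0; rewrite !inE ?ei0//.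
  by rewrite eta'E /a -/v divff// scale1r subrr eqxx.
have -> : \sum_i \sum_j A i j * (a i * Num.conj (a j) * N) =
          (\sum_i \sum_j a i * Num.conj (a j) * A i j) * N.
  rewrite mulr_suml; apply: eq_bigr => i _; rewrite mulr_suml.
  by apply: eq_bigr => j _; ring.
by rewrite mulr_ge0// dot_ge0.
Qed.

(** * Kernel vectors and a membership criterion in reproducing kernel spaces *)

Section Rkhs.
Variables (R : realType) (n : nat) (E : hilbert R) (K : kernel_fun R n).
Variable F : rkhs E K.
Local Notation C := R[i].

(** The vector K(., w) x; the default 0 can be reached only for w outside the ball. *)
Definition kvec (w : 'rV[C]_n) (x : E) : F :=
  xget 0 [set k : F | (forall z, unit_ball z -> ev k z = K z w *: x) /\
                      (forall f, dot f k = dot (ev f w) x)].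

Lemma dot_kvec f w x : unit_ball w -> dot f (kvec w x) = dot (ev f w) x.
Proof.
move=> bw; rewrite /kvec; case: xgetP => [k _ [_ /(_ f)]//|nk].
by have [k /nk] := ev_reproducing F x bw.
Qed.

Lemma ev_kvec z w x : unit_ball w -> unit_ball z -> ev (kvec w x) z = K z w *: x.
Proof.
move=> bw bz; rewrite /kvec; case: xgetP => [k _ [/(_ z bz)]//|nk].
by have [k /nk] := ev_reproducing F x bw.
Qed.

Lemma kvecZ a x w : unit_ball w -> kvec w (a *: x) = a *: kvec w x.
Proof.
by move=> bw; apply: dot_injr => h; rewrite dotZr !dot_kvec// dotZr.
Qed.

Lemma evD f g z : unit_ball z -> ev (f + g : F) z = ev f z + ev g z.
Proof. by move=> bz; have := ev_linear bz 1 f g; rewrite !scale1r. Qed.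

Lemma ev0 z : unit_ball z -> ev (0 : F) z = 0.
Proof. by move=> bz; apply: (addrI (ev (0 : F) z)); rewrite -evD// !addr0. Qed.

Lemma evZ a f z : unit_ball z -> ev (a *: f : F) z = a *: ev f z.
Proof. by move=> bz; have := ev_linear bz a f 0; rewrite ev0// !addr0. Qed.

Lemma ev_sum I (r : seq I) (P : pred I) (f : I -> F) z : unit_ball z ->
  ev (\sum_(i <- r | P i) f i) z = \sum_(i <- r | P i) ev (f i) z.
Proof.
move=> bz; elim/big_rec2: _ => [|i x y _ IH]; first exact: ev0.
by rewrite evD// IH.
Qed.

Lemma ev_eq (f g : F) : (forall z, unit_ball z -> ev f z = ev g z) -> f = g.
Proof.
move=> fg; apply/eqP; rewrite -subr_eq0; apply/eqP/ev_inj => z bz.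
by rewrite -scaleN1r evD// evZ// fg// scaleN1r subrr.
Qed.

Lemma ev_to_rkhs f z : in_rkhs F f -> unit_ball z -> ev (to_rkhs F f) z = f z.
Proof.
move=> [g gf] bz; rewrite /to_rkhs; case: xgetP => [h _ /(_ z bz)//|/(_ g)].
by case.
Qed.

(** Riesz representation of the functional sending sum_i K(., w_i) eta_i to the conjugate of sum_i
    <phi(w_i), eta_i>; the reproducing property then gives g = phi on the ball. As [riesz_relation]
    takes a graph, well-definedness needs no separate proof. *)
Lemma rkhs_membership (phi : 'rV[C]_n -> E) (M : R) : 0 <= M ->
  (forall (I : finType) (w : I -> 'rV[C]_n) (eta : I -> E),
     (forall i, unit_ball (w i)) ->
     complex.Re `|\sum_i dot (phi (w i)) (eta i)| <=
       M * hnorm (\sum_i kvec (w i) (eta i))) ->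
  exists2 g : F, hnorm g <= M & forall z, unit_ball z -> ev g z = phi z.
Proof.
move=> M0 Mle.
pose S (u : F) (c : C) := exists (I : finType) (w : I -> 'rV[C]_n) (eta : I -> E),
  [/\ forall i, unit_ball (w i), u = \sum_i kvec (w i) (eta i) &
      Num.conj c = \sum_i dot (phi (w i)) (eta i)].
have [|||g gM gS] := @riesz_relation R F S M _ _ _ M0.
- exists void, (fun=> 0), (fun=> 0); split=> [[]|| ].
  + by rewrite big1// => -[].
  + by rewrite rmorph0 big1// => -[].
- move=> a _ c _ d [I [w [eta [bw -> cE]]]] [J [w' [eta' [bw' -> dE]]]].
  exists (I + J)%type, (fun i => match i with inl i => w i | inr j => w' j end).
  exists (fun i => match i with inl i => a *: eta i | inr j => eta' j end).
  split=> [[]//||]; rewrite big_sumType/=.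
    by congr (_ + _); rewrite scaler_sumr; apply: eq_bigr => i _; rewrite kvecZ.
  rewrite rmorphD rmorphM/= cE dE; congr (_ + _); rewrite mulr_sumr.
  by apply: eq_bigr => i _; rewrite dotZr.
- move=> _ c [I [w [eta [bw -> cE]]]].
  by rewrite -norm_conjC cE; exact: Mle.
exists g => // z bz; apply: dot_injr => x.
have : S (kvec z x) (Num.conj (dot (phi z) x)).
  exists unit, (fun=> z), (fun=> x); split=> //; rewrite ?conjCK.
  - by rewrite (big_pred1 tt)// => -[].
  - by rewrite (big_pred1 tt)// => -[].
move/gS; rewrite (dotC (kvec z x)) dot_kvec// => /(can_inj conjCK) e.
by rewrite dotC e -dotC.
Qed.

End Rkhs.

(** * Row contractivity of M_z on the vector-valued space *)

Section RowContraction.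
Variables (R : realType) (n : nat) (K : kernel_fun R n).
Local Notation C := R[i].

Lemma dot_sum_kvec (E : hilbert R) (F : rkhs E K) (I : finType)
    (w : I -> 'rV[C]_n) (x y : I -> E) : (forall i, unit_ball (w i)) ->
  dot (\sum_i kvec F (w i) (x i)) (\sum_i kvec F (w i) (y i)) =
  \sum_i \sum_j K (w j) (w i) * dot (x i) (y j).
Proof.
move=> bw; rewrite dot_suml; apply: eq_bigr => i _.
rewrite dot_sumr; apply: eq_bigr => j _.
by rewrite dot_kvec// ev_kvec// dotZl.
Qed.

Lemma adjoint_eq (E F : hilbert R) (T : E -> F) y x :
  (forall h, dot (T h) y = dot h x) -> adjoint T y = x.
Proof.
move=> Tx; rewrite /adjoint; case: xgetP => [z _ Tz|/(_ x)/(_ Tx)//].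
by apply: dot_injr => h; rewrite -Tx -Tz.
Qed.

(** Kernel vectors are eigenvectors of the adjoint of M_z, with eigenvalue the conjugate of w_l. *)
Lemma dot_Mz_kvec (E : hilbert R) (F : rkhs E K) l f w x :
  in_rkhs F (coord_mul l f) -> unit_ball w ->
  dot (Mz l f) (kvec F w x) = dot f (kvec F w (Num.conj (w 0 l) *: x)).
Proof.
by move=> lf bw; rewrite !dot_kvec// ev_to_rkhs// dotZl dotZr conjCK.
Qed.

(** This is P_T(I) <= I tested on combinations of kernel vectors, which the adjoints of M_z multiply
    by scalars. *)
Lemma row_kernel_psd (HK : rkhs (complex_hilbert R) K) :
  contractive_analytic HK ->
  forall (I : finType) (w : I -> 'rV[C]_n) (c : I -> C),
    (forall i, unit_ball (w i)) ->
    0 <= \sum_i \sum_j c i * Num.conj (c j) *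
           (K (w j) (w i) * (1 - \sum_l Num.conj (w i 0 l) * w j 0 l)).
Proof.
move=> cK I w c bw.
pose x (a : I -> C) i : complex_hilbert R := a i.
pose h := \sum_i kvec HK (w i) (x c i).
pose y l := \sum_i kvec HK (w i) (x (fun i => Num.conj (w i 0 l) * c i) i).
have adj l : adjoint (Mz (F := HK) l) h = y l.
  apply: adjoint_eq => f; rewrite !dot_sumr; apply: eq_bigr => i _.
  by rewrite dot_Mz_kvec//; exact: (ca_invariant cK).
have := rc_le1 (ca_row_contraction cK) h.
have -> : dot (P_map (Mz (F := HK)) id h) h = \sum_l dot (y l) (y l).
  rewrite dot_suml; apply: eq_bigr => l _ /=; rewrite adj.
  rewrite {2}/y !dot_sumr; apply: eq_bigr => i _.
  by rewrite dot_Mz_kvec//; exact: (ca_invariant cK).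
rewrite -subr_ge0; congr (0 <= _).
under eq_bigr => l _ do rewrite dot_sum_kvec//.
rewrite dot_sum_kvec// [X in _ - X]exchange_big -sumrB; apply: eq_bigr => i _.
rewrite [X in _ - X]exchange_big -sumrB; apply: eq_bigr => j _.
have dx a b : dot (x a i) (x b j) = a i * Num.conj (b j) by [].
under eq_bigr => l _ do rewrite dx rmorphM/= conjCK.
rewrite dx [RHS]mulrA [RHS]mulrBr mulr1 (mulrC (K _ _)).
congr (_ - _); rewrite mulr_sumr; apply: eq_bigr => l _; ring.
Qed.

Variable HK : rkhs (complex_hilbert R) K.
Hypothesis cK : contractive_analytic HK.
Variables (E : hilbert R) (F : rkhs E K).

(** The difference of the two sides is the sum of the entries of the Schur product of the matrix in
    [row_kernel_psd] with the Gram matrix of eta, so [psd_gram] applies. *)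
Lemma kvec_row (I : finType) (w : I -> 'rV[C]_n) (eta : I -> E) :
  (forall i, unit_ball (w i)) ->
  \sum_l hnorm (\sum_i kvec F (w i) (Num.conj (w i 0 l) *: eta i)) ^+ 2 <=
  hnorm (\sum_i kvec F (w i) (eta i)) ^+ 2.
Proof.
move=> bw; rewrite -lecR rmorph_sum/=.
under eq_bigr => l _ do rewrite -dot_hnorm dot_sum_kvec//.
rewrite -dot_hnorm dot_sum_kvec// -subr_ge0.
have /(psd_gram eta) := row_kernel_psd cK (w := w) ^~ bw.
congr (0 <= _); rewrite [X in _ - X]exchange_big -sumrB; apply: eq_bigr => i _.
rewrite [X in _ - X]exchange_big -sumrB; apply: eq_bigr => j _.
rewrite mulrBr mulr1 mulrBl; congr (_ - _).
rewrite mulr_sumr mulr_suml; apply: eq_bigr => l _.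
rewrite dotZl dotZr conjCK; ring.
Qed.

(** Pairing the function with sum_i K(., w_i) eta_i gives sum_l <g_l, h_l>, where h_l is the l-th
    sum in [kvec_row]; Cauchy-Schwarz and [kvec_row] bound it. Working with functions rather than
    [Mz] also yields invariance under the coordinates. *)
Lemma row_multiplication (g : 'I_n -> F) :
  exists2 G : F, hnorm G ^+ 2 <= \sum_l hnorm (g l) ^+ 2 &
    forall z, unit_ball z -> ev G z = \sum_l z 0 l *: ev (g l) z.
Proof.
set N := \sum_l _; have N0 : 0 <= N by apply: sumr_ge0 => l _; exact: sqr_ge0.
have [|G GN Gz] := @rkhs_membership _ _ _ _ F
    (fun z => \sum_l z 0 l *: ev (g l) z) (Num.sqrt N) (sqrtr_ge0 _).
- move=> I w eta bw.
  pose h l := \sum_i kvec F (w i) (Num.conj (w i 0 l) *: eta i).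
  have -> : \sum_i dot (\sum_l w i 0 l *: ev (g l) (w i)) (eta i) =
            \sum_l dot (g l) (h l).
    under [RHS]eq_bigr => l _ do rewrite dot_sumr.
    rewrite exchange_big; apply: eq_bigr => i _ /=; rewrite dot_suml.
    by apply: eq_bigr => l _; rewrite dot_kvec// dotZr dotZl conjCK.
  apply: (@le_trans _ _ (\sum_l hnorm (g l) * hnorm (h l))).
    rewrite -lecR RRe_real ?normr_real// rmorph_sum.
    apply: (@le_trans _ _ (\sum_l `|dot (g l) (h l)|)); first exact: ler_norm_sum.
    apply: ler_sum => l _; rewrite rmorphM/= -!hnormE; exact: dot_le.
  rewrite -(ler_pXn2r (n:=2))// ?nnegrE ?mulr_ge0 ?sqrtr_ge0 ?hnorm_ge0//; last first.
    by apply: sumr_ge0 => l _; rewrite mulr_ge0 ?hnorm_ge0.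
  rewrite exprMn sqr_sqrtr//; apply: le_trans (sum_mulr_sqr _ _) _.
  by rewrite ler_wpM2l// kvec_row.
exists G => //; rewrite -(sqr_sqrtr N0).
by rewrite ler_pXn2r// ?nnegrE ?sqrtr_ge0 ?hnorm_ge0.
Qed.

Lemma ev_Mz l (f : F) z : unit_ball z -> ev (Mz l f) z = z 0 l *: ev f z.
Proof.
move=> bz; rewrite ev_to_rkhs//.
(* A row whose only nonzero entry is f, in position l. *)
have [G _ GE] := row_multiplication (fun k => if k == l then f else 0).
exists G => y yb; rewrite GE// (bigD1 l)//= eqxx big1 ?addr0//.
by move=> k /negPf ->; rewrite ev0// scaler0.
Qed.

Lemma Mz_row (g : 'I_n -> F) :
  hnorm (\sum_l Mz l (g l)) ^+ 2 <= \sum_l hnorm (g l) ^+ 2.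
Proof.
have [G GN GE] := row_multiplication g.
suff -> : \sum_l Mz l (g l) = G by [].
apply: ev_eq => z bz; rewrite GE// ev_sum//.
by apply: eq_bigr => l _; rewrite ev_Mz.
Qed.

End RowContraction.

(** * Norm bounds and adjoints of bounded operators *)

Lemma bounded_linear_le (R : realType) (E F : hilbert R) (T : E -> F) :
  bounded_linear T -> exists2 B, 0 <= B & forall x, hnorm (T x) <= B * hnorm x.
Proof.
move=> [Tl Tb].
have T0 : T 0 = 0 by have := Tl (-1) 0 0; rewrite scaler0 addr0 scaleN1r addNr.
have TZ a x : T (a *: x) = a *: T x by rewrite -[a *: x]addr0 Tl T0 addr0.
have Tle x : `|x| <= 1 -> ((hnorm (T x))%:E <= op_norm T)%E.
  by move=> x1; apply: ereal_sup_ubound; exists x.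
have oE : op_norm T = (fine (op_norm T))%:E.
  rewrite fineK// fin_real// Tb andbT.
  by apply: lt_le_trans (Tle 0 _); rewrite ?ltNyr// normr0.
exists (fine (op_norm T)) => [|x].
  by rewrite -lee_fin -oE; apply: le_trans (Tle 0 _); rewrite ?normr0// lee_fin hnorm_ge0.
have [->|x0] := eqVneq x 0.
  by rewrite T0 !hnorm0 mulr0.
have nx0 : 0 < hnorm x by rewrite lt0r hnorm_eq0 x0 hnorm_ge0.
rewrite -ler_pdivrMr//.
have nV : complex.Re `|(((hnorm x)^-1)%:C)%C : R[i]| = (hnorm x)^-1.
  by rewrite ger0_norm// lecR invr_ge0 ltW.
have := Tle ((((hnorm x)^-1)%:C)%C *: x); rewrite TZ hnormE !hnormZ nV.
by rewrite mulVf ?gt_eqF// mulrC oE lee_fin; apply.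
Qed.

(** Riesz representation of the everywhere defined bounded functional x |-> <T x, eta>. *)
Lemma adjoint_exists (R : realType) (E F : hilbert R) (T : E -> F) eta :
  bounded_linear T -> exists y, forall x, dot (T x) eta = dot x y.
Proof.
move=> Tb; have [B B0 TB] := bounded_linear_le Tb; have [Tl _] := Tb.
pose S x c := c = dot (T x) eta.
have SP a u c v d : S u c -> S v d -> S (a *: u + v) (a * c + d).
  by rewrite /S => -> ->; rewrite Tl dotDl dotZl.
have S0 : S 0 0.
  have := @SP (-1) 0 _ 0 _ erefl erefl.
  by rewrite scaler0 addr0 mulN1r addNr.
have [u c ->||y _ yP] := riesz_relation S0 SP (M := B * hnorm eta).
- by rewrite (le_trans (Re_dot_le _ _))// mulrAC ler_wpM2r ?hnorm_ge0.
- by rewrite mulr_ge0// hnorm_ge0.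
by exists y => x; rewrite (yP x (dot (T x) eta)).
Qed.

(** * Limits of truncated geometric sums *)

Section Geometric.
Variables (R : realType) (I : finType) (q d : I -> R[i]).

(** The difference X - N_m is sum_i q_i^m d_i / (1 - q_i), at most D r^m for r the largest |q_i|,
    and this tends to 0. *)
Lemma geometric_sum_le (X B : R) :
  (forall i, `|q i| < 1) ->
  (X%:C)%C = \sum_i (1 - q i)^-1 * d i ->
  (forall m, exists2 N : R, N <= B &
     (N%:C)%C = \sum_i (\sum_(p < m) q i ^+ p) * d i) ->
  X <= B.
Proof.
move=> q1 XE NE.
pose c i := (1 - q i)^-1 * d i.
(* Starting the maximum at 0 covers an empty [I]. *)
pose r := \big[Num.max/0]_i complex.Re `|q i|.
have rq i : `|q i| <= (r%:C)%C.
  by rewrite -[`|q i|]RRe_real ?normr_real// lecR; exact: le_bigmax.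
have r0 : 0 <= r by exact: bigmax_ge_id.
have r1 : r < 1.
  apply: bigmax_lt => // i _.
  by rewrite -ltcR RRe_real ?normr_real.
pose D := complex.Re (\sum_i `|c i|).
have DE : (D%:C)%C = \sum_i `|c i|.
  by rewrite RRe_real// ger0_real// sumr_ge0.
have XB m : X <= B + D * r ^+ m.
  have [N NB Nm] := NE m.
  rewrite -lerBlDl (le_trans (lerB (lexx X) NB))//.
  apply: le_trans (ler_norm _) _.
  rewrite -lecR.
  have -> : ((`|X - N|)%:C)%C = `|((X - N)%:C)%C : R[i]|.
    by rewrite normc_def/= expr0n addr0 sqrtr_sqr.
  have -> : ((X - N)%:C)%C = \sum_i q i ^+ m * c i.
    rewrite rmorphB/= XE Nm -sumrB; apply: eq_bigr => i _.
    have qn : 1 - q i != 0.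
      by rewrite subr_eq0 eq_sym; apply: contraTneq (q1 i) => ->; rewrite normr1 ltxx.
    have -> : \sum_(p < m) q i ^+ p = (1 - q i ^+ m) * (1 - q i)^-1.
      apply: (canRL (mulfK qn)); rewrite mulrC.
      by rewrite -opprB mulNr -subrX1 opprB.
    by rewrite /c; ring.
  rewrite rmorphM/= DE rmorphXn/= mulr_suml.
  apply: (@le_trans _ _ (\sum_i `|q i ^+ m * c i|)); first exact: ler_norm_sum.
  apply: ler_sum => i _; rewrite normrM normrX mulrC ler_wpM2l//.
  by rewrite lerXn2r// ?nnegrE// lecR.
rewrite leNgt; apply/negP => BX.
have e0 : 0 < X - B by rewrite subr_gt0.
have rn : `|r| < 1 by rewrite ger0_norm.
have /cvgrPdist_lt Dr := cvg_geometric D rn.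
have [m _ /(_ m (leqnn m))] := Dr _ e0.
rewrite /geometric/= sub0r normrN => /(le_lt_trans (ler_norm _)).
have := XB m; lra.
Qed.

End Geometric.

(** * The Hermitian form of C^n on the unit ball *)

Section Ball.
Variables (R : realType) (n : nat).
Local Notation C := R[i].

Definition rv_dot (z w : 'rV[C]_n) : C := \sum_l z 0 l * Num.conj (w 0 l).

(** Summing 2 |a b| <= |a|^2 + |b|^2 over the coordinates suffices, without square roots. *)
Lemma norm_rv_dot_lt1 z w : unit_ball z -> unit_ball w -> `|rv_dot z w| < 1.
Proof.
rewrite /unit_ball => bz bw.
have : `|rv_dot z w| *+ 2 <= \sum_i `|z 0 i| ^+ 2 + \sum_i `|w 0 i| ^+ 2.
  apply: (@le_trans _ _ (\sum_l (`|z 0 l| * `|w 0 l|) *+ 2)).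
    rewrite sumrMnl lerMn2r/=; apply: le_trans (ler_norm_sum _ _ _) _.
    by apply: ler_sum => l _; rewrite normrM norm_conjC.
  rewrite -big_split; apply: ler_sum => l _ /=.
  rewrite -subr_ge0.
  have -> : `|z 0 l| ^+ 2 + `|w 0 l| ^+ 2 - (`|z 0 l| * `|w 0 l|) *+ 2 =
            (`|z 0 l| - `|w 0 l|) ^+ 2 by ring.
  by rewrite -realEsqr rpredB ?normr_real.
move=> /le_lt_trans/(_ (ltrD bz bw)).
by rewrite -[1 + 1]/(1 *+ 2) ltrMn2r.
Qed.

End Ball.

(** * Wandering subspace estimates for a K-inner function *)

Section Inner.
Variables (R : realType) (n : nat) (K : kernel_fun R n).
Local Notation C := R[i].
Variable HK : rkhs (complex_hilbert R) K.
Hypothesis cK : contractive_analytic HK.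
Variables (E Estar : hilbert R) (F : rkhs Estar K).
Variable Theta : 'rV[C]_n -> bounded_operator E Estar.
Hypothesis inner : K_inner F Theta.
Local Notation V := (Theta_vec F Theta).
Local Notation T := (@Mz _ _ _ _ F).

Let ThetaP z a x y : Theta z (a *: x + y) = a *: Theta z x + Theta z y.
Proof. by have [-> _] := bop_bounded (Theta z). Qed.

Let ThetaD z x y : Theta z (x + y) = Theta z x + Theta z y.
Proof. by have := ThetaP z 1 x y; rewrite !scale1r. Qed.

Let Theta0 z : Theta z 0 = 0.
Proof. by apply: (addrI (Theta z 0)); rewrite -ThetaD !addr0. Qed.

Let ThetaZ z a x : Theta z (a *: x) = a *: Theta z x.
Proof. by have := ThetaP z a x 0; rewrite Theta0 !addr0. Qed.

Let Theta_sum z I (r : seq I) (P : pred I) (f : I -> E) :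
  Theta z (\sum_(i <- r | P i) f i) = \sum_(i <- r | P i) Theta z (f i).
Proof. by elim/big_rec2: _ => [|i x y _ IH]; rewrite ?Theta0// ThetaD IH. Qed.

Let ev_V x z : unit_ball z -> ev (V x) z = Theta z x.
Proof. by move=> bz; rewrite ev_to_rkhs//; exact: (ki_mem inner). Qed.

Let hnorm_V x : hnorm (V x) = hnorm x.
Proof. by rewrite /hnorm (ki_norm inner). Qed.

(** Reduces identities between products of the M_z to monomial identities at each point. *)
Lemma ev_multi_power k f z : unit_ball z ->
  ev (multi_power T k f) z = (\prod_l z 0 l ^+ k l) *: ev f z.
Proof.
move=> bz; rewrite /multi_power; elim/big_rec2: _ f => [|l c X _ IH] f.
  by rewrite scale1r.
rewrite /=; rewrite -scalerA -IH.
elim: (k l) => [|m IHm]; first by rewrite scale1r.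
by rewrite iterS (ev_Mz cK)// IHm scalerA exprS.
Qed.

Lemma multi_power1 l f :
  multi_power T (fun i : 'I_n => nat_of_bool (i == l)) f = T l f.
Proof.
apply: ev_eq => z bz; rewrite ev_multi_power// (ev_Mz cK)//; congr (_ *: _).
rewrite (bigD1 l)//= eqxx expr1 big1 ?mulr1// => i /negPf ->.
by rewrite expr0.
Qed.

Section Sum.
Variables (I : finType) (w : I -> 'rV[C]_n).

(* [inner_sum m y] is [\sum_a M_z^a V x_a] for [x_a = \sum_i conj (w_i^a) y_i],
   over the words [a] of length at most [m], and [weight m y] is
   [\sum_a |x_a|^2]. *)
Fixpoint inner_sum m (y : I -> E) : F :=
  V (\sum_i y i) + if m is m'.+1 then
    \sum_l T l (inner_sum m' (fun i => Num.conj (w i 0 l) *: y i)) else 0.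

Fixpoint weight m (y : I -> E) : R :=
  hnorm (\sum_i y i) ^+ 2 + if m is m'.+1 then
    \sum_l weight m' (fun i => Num.conj (w i 0 l) *: y i) else 0.

(** Every term is M_z^a V x_a, and M_z^k M_z^a has nonzero exponent because k does. A general k lets
    the induction absorb the outer [T l] into the exponent. *)
Lemma inner_sum_wandering m x y k : (exists i, k i != 0%N) ->
  dot (V x) (multi_power T k (inner_sum m y)) = 0.
Proof.
elim: m y k => [|m IH] y k k0 /=; first by rewrite addr0 (ki_wandering inner).
pose k' l i := (k i + (i == l))%N.
have -> : multi_power T k (V (\sum_i y i) +
      \sum_l T l (inner_sum m (fun i => Num.conj (w i 0 l) *: y i))) =
    multi_power T k (V (\sum_i y i)) + \sum_l
      multi_power T (k' l) (inner_sum m (fun i => Num.conj (w i 0 l) *: y i)).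
  apply: ev_eq => z bz.
  rewrite evD// !ev_multi_power// evD// scalerDr !ev_sum//; congr (_ + _).
  rewrite scaler_sumr; apply: eq_bigr => l _.
  rewrite ev_multi_power// (ev_Mz cK)// scalerA; congr (_ *: _).
  under [RHS]eq_bigr => i _ do rewrite exprD.
  rewrite big_split/=; congr (_ * _).
  rewrite (bigD1 l)//= eqxx expr1 big1 ?mulr1// => i /negPf ->.
  by rewrite expr0.
rewrite dotDr (ki_wandering inner)// add0r dot_sumr big1// => l _.
by apply: IH; exists l; rewrite /k' eqxx addn1.
Qed.

Lemma inner_sum_le m y : hnorm (inner_sum m y) ^+ 2 <= weight m y.
Proof.
elim: m y => [|m IH] y /=; first by rewrite !addr0 hnorm_V.
(* The terms of positive degree are orthogonal to the constant term, so squared norms add; [Mz_row]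
   then removes the outer [T l]. *)
set B := \sum_l T l _; have VB : dot (V (\sum_i y i)) B = 0.
  rewrite dot_sumr big1// => l _; rewrite -multi_power1.
  by apply: inner_sum_wandering; exists l; rewrite eqxx.
rewrite sqr_hnormD hnorm_V VB mulr0 addr0 lerD2l.
by apply: le_trans (Mz_row cK _) _; apply: ler_sum => l _.
Qed.

(** Over words a of length p, the products z^a conj(w^a) sum to the p-th power of [rv_dot z w];
    lengths 0 to m give m + 1 powers. *)
Lemma ev_inner_sum m y z : unit_ball z ->
  ev (inner_sum m y) z =
  Theta z (\sum_i (\sum_(p < m.+1) rv_dot z (w i) ^+ p) *: y i).
Proof.
move=> bz; elim: m y => [|m IH] y /=.
  rewrite addr0 ev_V//; congr (Theta z _); apply: eq_bigr => i _.
  by rewrite big_ord1 expr0 scale1r.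
rewrite evD// ev_sum// ev_V//.
under [X in _ + X]eq_bigr => l _ do rewrite (ev_Mz cK)// IH -ThetaZ.
rewrite -Theta_sum -ThetaD; congr (Theta z _).
under [X in _ + X]eq_bigr => l _ do rewrite scaler_sumr.
rewrite [X in _ + X]exchange_big -big_split; apply: eq_bigr => i _ /=.
rewrite [in RHS]big_ord_recl expr0 scalerDl scale1r; congr (_ + _).
under eq_bigr => l _ do rewrite !scalerA.
rewrite -scaler_suml; congr (_ *: _).
under [RHS]eq_bigr => p _ do rewrite exprS.
rewrite -mulr_sumr mulr_suml; apply: eq_bigr => l _; ring.
Qed.

(** The same summation over words; for w_i in the ball, the limit in m is the squared norm of sum_i
    k(., w_i) y_i. *)
Lemma weightE m y : ((weight m y)%:C)%C =
  \sum_i \sum_j (\sum_(p < m.+1) rv_dot (w j) (w i) ^+ p) * dot (y i) (y j).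
Proof.
elim: m y => [|m IH] y /=.
  rewrite addr0 -dot_hnorm dot_suml; apply: eq_bigr => i _.
  by rewrite dot_sumr; apply: eq_bigr => j _; rewrite big_ord1 expr0 mul1r.
rewrite rmorphD rmorph_sum /= -[X in X + _]dot_hnorm.
under [X in _ + X]eq_bigr => l _ do rewrite IH.
rewrite [X in _ + X]exchange_big dot_suml -big_split; apply: eq_bigr => i _ /=.
rewrite [X in _ + X]exchange_big dot_sumr -big_split; apply: eq_bigr => j _ /=.
rewrite [in RHS]big_ord_recl expr0 mulrDl mul1r; congr (_ + _).
under eq_bigr => l _ do rewrite dotZl dotZr conjCK.
have -> : \sum_(p < m.+1) rv_dot (w j) (w i) ^+ lift ord0 p =
    rv_dot (w j) (w i) * \sum_(p < m.+1) rv_dot (w j) (w i) ^+ p.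
  by rewrite mulr_sumr; apply: eq_bigr => p _; rewrite -exprS.
move: (\sum_(p < m.+1) _) => S.
by rewrite /rv_dot !mulr_suml; apply: eq_bigr => l _; ring.
Qed.

Hypothesis bw : forall i, unit_ball (w i).
Variables (eta : I -> Estar) (y : I -> E).
Hypothesis yP : forall i x, dot (Theta (w i) x) (eta i) = dot x (y i).

Lemma weight_le m : weight m y <= hnorm (\sum_i kvec F (w i) (eta i)) ^+ 2.
Proof.
set h := \sum_i _.
have wE : dot (inner_sum m y) h = ((weight m y)%:C)%C.
  rewrite weightE exchange_big dot_sumr; apply: eq_bigr => j _ /=.
  rewrite dot_kvec// ev_inner_sum// yP dot_suml.
  by apply: eq_bigr => i _; rewrite dotZl.
have w0 : 0 <= weight m y := le_trans (sqr_ge0 _) (inner_sum_le m y).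
set g := hnorm (inner_sum m y).
have wg : weight m y <= g * hnorm h.
  by have := Re_dot_le (inner_sum m y) h; rewrite wE ger0_norm ?lecR.
have gw : g ^+ 2 <= weight m y by exact: inner_sum_le.
have g0 : 0 <= g by exact: hnorm_ge0.
have h0 : 0 <= hnorm h by exact: hnorm_ge0.
(* From g^2 <= weight <= g |h|, cancelling a nonzero g gives g <= |h|, and then weight <= |h|^2. *)
have gh : g <= hnorm h.
  have [->//|gn0] := eqVneq g 0.
  by rewrite -(ler_pM2l (x:=g)) ?lt0r ?gn0// -expr2 (le_trans gw).
by rewrite (le_trans wg)// expr2 ler_wpM2r.
Qed.

Lemma sum_drury_arveson_le (H2E : rkhs E (@drury_arveson R n)) :
  hnorm (\sum_i kvec H2E (w i) (y i)) <= hnorm (\sum_i kvec F (w i) (eta i)).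
Proof.
rewrite -(ler_pXn2r (n:=2))// ?nnegrE ?hnorm_ge0//.
apply: (@geometric_sum_le R _ (fun p : I * I => rv_dot (w p.2) (w p.1))
          (fun p => dot (y p.1) (y p.2))).
- by move=> p; exact: norm_rv_dot_lt1.
- by rewrite -dot_hnorm dot_sum_kvec// pair_bigA.
(* The truncation with m + 1 powers is [weight m y]; the empty one is 0. *)
case=> [|m]; [exists 0; first exact: sqr_ge0|exists (weight m y)].
- by rewrite big1// => p _; rewrite big_ord0 mul0r.
- exact: weight_le.
- by rewrite weightE pair_bigA.
Qed.

End Sum.

(** Pairing Theta f with sum_i K(., w_i) eta_i amounts to pairing f with sum_i k(., w_i) y_i, so
    [sum_drury_arveson_le] supplies the bound |f| for [rkhs_membership]. *)
Lemma inner_membership (H2E : rkhs E (@drury_arveson R n)) (f : H2E) :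
  exists2 g : F, hnorm g <= hnorm f &
    forall z, unit_ball z -> ev g z = Theta z (ev f z).
Proof.
apply: rkhs_membership (hnorm_ge0 f) _ => I w eta bw.
have /choice[y yP] : forall i, exists y, forall x,
    dot (Theta (w i) x) (eta i) = dot x y.
  by move=> i; apply: adjoint_exists; exact: bop_bounded.
have -> : \sum_i dot (Theta (w i) (ev f (w i))) (eta i) =
          dot f (\sum_i kvec H2E (w i) (y i)).
  by rewrite dot_sumr; apply: eq_bigr => i _; rewrite yP dot_kvec.
apply: le_trans (Re_dot_le _ _) _.
by rewrite ler_wpM2l ?hnorm_ge0// (sum_drury_arveson_le bw yP).
Qed.

End Inner.

Theorem theorem6p2 (R : realType) (n : nat) (K : kernel_fun R n)
    (HK : rkhs (complex_hilbert R) K) (E Estar : hilbert R)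
    (H2E : rkhs E (@drury_arveson R n)) (HKE : rkhs Estar K)
    (Theta : 'rV[R[i]]_n -> bounded_operator E Estar) :
  positive_definite K -> contractive_analytic HK ->
  K_inner HKE Theta ->
  K_multiplier H2E HKE Theta /\
  (op_norm (M_Theta H2E HKE Theta) <= 1)%E.
Proof.
move=> _ cK inner.
have mult : K_multiplier H2E HKE Theta.
  by move=> f; have [g _ gE] := inner_membership cK inner f; exists g.
split=> //; apply: ge_ereal_sup => _ [f /= f1 <-].
have [g gf gE] := inner_membership cK inner f.
(* [M_Theta] picks its value by choice; injectivity of [ev] identifies it with [g]. *)
have -> : M_Theta H2E HKE Theta f = g.
  by apply: ev_eq => z bz; rewrite gE// ev_to_rkhs//; exact: mult.
by rewrite lee_fin; apply: le_trans gf _; rewrite -lecR -hnormE.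
Qed.
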